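(* Let $d,n\ge1$ and let $p$ be an $n$-variate block-multilinear polynomial of degree $d$ that $1/3$-approximates a Boolean function $f\colon\{-1,1\}^n\to\{-1,1\}$. Then $\deg(f)\le d$.
   Context: A multilinear real polynomial $p(x)=\sum_{S\subseteq[n]}\hat p(S)\prod_{i\in S}x_i$ is block-multilinear of degree $d$ if the variables $x_1,\dots,x_n$ can be partitioned into $d$ disjoint blocks $A_1,\dots,A_d$ such that every monomial of $p$ contains at most one variable from each block (so in particular $p$ has degree at most $d$). $p$ $1/3$-approximates $f$ if $|p(x)-f(x)|\le1/3$ for every $x\in\{-1,1\}^n$. $\deg(f)$ is the degree of the unique real multilinear polynomial representing $f$ on $\{-1,1\}^n$, i.e. $\max\{|S|:\hat f(S)\neq0\}$, where $\hat f(S)=\mathbb{E}_x[f(x)\prod_{i\in S}x_i]$. *)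

(* Defs.v *)
From HB Require Import structures.
From mathcomp Require Export all_boot all_order all_algebra.
From mathcomp Require Export reals mpoly.

Set Implicit Arguments.
Unset Strict Implicit.
Unset Printing Implicit Defensive.

Import Order.TTheory GRing.Theory Num.Theory.
Local Open Scope ring_scope.

Definition multilinear (R : realType) (n : nat) (p : {mpoly R[n]}) : Prop :=
  forall m : 'X_{1..n}, m \in msupp p -> forall i : 'I_n, (m i <= 1)%N.

(* Blocks may be empty: when d <= n this gives the same class of polynomials
   as nonempty blocks, and it keeps the notion meaningful when d > n. *)
Definition block_multilinear (R : realType) (n : nat) (d : nat)
    (p : {mpoly R[n]}) : Prop :=
  multilinear p /\
  exists A : 'I_d -> {set 'I_n},
    [/\ forall j k : 'I_d, j != k -> [disjoint A j & A k],
        \bigcup_(j : 'I_d) A j = [set: 'I_n]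
      & forall m : 'X_{1..n}, m \in msupp p ->
          forall j : 'I_d, (#|[set i in A j | 0 < m i]| <= 1)%N].

(* The two-element set {-1,1} is encoded by bool, with false and true standing
   for 1 and -1; a point of {-1,1}^n is an element of {ffun 'I_n -> bool}. *)
Definition pm1 (R : realType) (b : bool) : R := (-1) ^+ b.

Definition approximates (R : realType) (n : nat) (eps : R) (p : {mpoly R[n]})
    (f : {ffun 'I_n -> bool} -> bool) : Prop :=
  forall x : {ffun 'I_n -> bool},
    `|p.@[fun i => pm1 R (x i)] - pm1 R (f x)| <= eps.

Definition fourier (R : realType) (n : nat) (f : {ffun 'I_n -> bool} -> bool)
    (S : {set 'I_n}) : R :=
  (\sum_(x : {ffun 'I_n -> bool}) pm1 R (f x) * \prod_(i in S) pm1 R (x i))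
    / 2%:R ^+ n.

Definition bdeg (R : realType) (n : nat) (f : {ffun 'I_n -> bool} -> bool)
    : nat :=
  \max_(S : {set 'I_n} | fourier R f S != 0) #|S|.

(* Main.v *)
(** A block-multilinear polynomial has zero mixed second difference in two
    variables [i], [k] of the same block, so the mixed second difference of [f]
    is at most [4/3] in absolute value. As a signed sum of four signs it is an
    even integer, hence it vanishes. So [f] has no Fourier coefficient on a set
    containing two variables of one block, and by pigeonhole every set with more
    than [d] elements is of this kind. *)
Require Import Defs.
From mathcomp Require Import all_boot all_order all_algebra.
From mathcomp Require Import reals mpoly.
From mathcomp Require Import ring lra.
Set Implicit Arguments.
Unset Strict Implicit.
Unset Printing Implicit Defensive.
Import Order.TTheory GRing.Theory Num.Theory.
Local Open Scope ring_scope.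

(** Since [true] encodes -1, the xor negates coordinate [i]. *)
Definition flip (n : nat) (i : 'I_n) (x : {ffun 'I_n -> bool}) :
  {ffun 'I_n -> bool} := [ffun l => x l (+) (l == i)].

Lemma flipK n (i : 'I_n) : involutive (flip i).
Proof. by move=> x; apply/ffunP => l; rewrite !ffunE addbK. Qed.

Lemma prod_pm1_flip (R : realType) n (i : 'I_n) (x : {ffun 'I_n -> bool})
    (S : {set 'I_n}) : i \in S ->
  \prod_(l in S) pm1 R (flip i x l) = - \prod_(l in S) pm1 R (x l).
Proof.
move=> iS; rewrite !(bigD1 i iS) /= -mulNr; congr (_ * _).
  by rewrite ffunE eqxx /pm1 signr_addb expr1 mulrN1.
by apply: eq_bigr => l /andP[_ /negPf li]; rewrite ffunE li addbF.
Qed.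

Lemma sum_flip (V : zmodType) n (i : 'I_n) (g : {ffun 'I_n -> bool} -> V) :
  \sum_x g (flip i x) = \sum_x g x.
Proof. by rewrite [RHS](reindex_inj (inv_inj (flipK i))). Qed.

Lemma monomial_flip (R : realType) n (m : 'X_{1..n}) (i : 'I_n)
    (x : {ffun 'I_n -> bool}) : m i = 0%N ->
  \prod_l pm1 R (flip i x l) ^+ m l = \prod_l pm1 R (x l) ^+ m l.
Proof.
move=> mi0; apply: eq_bigr => l _; rewrite ffunE.
by have [->|_] := eqVneq l i; rewrite ?mi0 ?expr0 ?addbF.
Qed.

(** Each monomial misses [i] or [k], so one of the two flips fixes it and its four terms cancel in
    pairs. *)
Lemma meval_second_difference (R : realType) n (p : {mpoly R[n]}) (i k : 'I_n)
    (x : {ffun 'I_n -> bool}) :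
    (forall m, m \in msupp p -> (m i == 0%N) || (m k == 0%N)) ->
  p.@[fun l => pm1 R (x l)] - p.@[fun l => pm1 R (flip i x l)]
  - p.@[fun l => pm1 R (flip k x l)]
  + p.@[fun l => pm1 R (flip i (flip k x) l)] = 0.
Proof.
move=> mik; rewrite !mevalE -!sumrB -big_split /= big1_seq // => m /andP[_ mp].
(* When [m k = 0], the flip of [k] must be outermost for [monomial_flip] to remove it. *)
have flipC : flip i (flip k x) = flip k (flip i x).
  by apply/ffunP => l; rewrite !ffunE addbAC.
case/orP: (mik m mp) => /eqP m0.
  by rewrite !(monomial_flip _ _ m0) subrr sub0r addNr.
by rewrite flipC !(monomial_flip _ _ m0); ring.
Qed.

(** With [eps] below 1/2 the four errors total less than 2, the least nonzero absolute value of a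
    signed sum of four signs. *)
Lemma approximates_second_difference (R : realType) n (eps : R)
    (p : {mpoly R[n]}) (f : {ffun 'I_n -> bool} -> bool) (i k : 'I_n)
    (x : {ffun 'I_n -> bool}) :
    eps < 1 / 2%:R -> approximates eps p f ->
    (forall m, m \in msupp p -> (m i == 0%N) || (m k == 0%N)) ->
  pm1 R (f x) - pm1 R (f (flip i x)) - pm1 R (f (flip k x))
  + pm1 R (f (flip i (flip k x))) = 0.
Proof.
move=> eps_lt pf /(meval_second_difference x).
move: (pf x) (pf (flip i x)) (pf (flip k x)) (pf (flip i (flip k x))).
(* In each of the 16 sign patterns, either the goal holds numerically or the error bounds contradict
   the zero difference of [p]. *)
by case: (f x) (f (flip i x)) (f (flip k x)) (f (flip i (flip k x)))
  => [] [] [] []; rewrite /pm1 ?expr1 ?expr0 !ler_norml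
  => /andP[? ?] /andP[? ?] /andP[? ?] /andP[? ?] ?; lra.
Qed.

(** Either flip negates the character of [S] and both together preserve it, so summing over the four
    flips brings out the mixed difference of [f] as a factor. *)
Lemma fourier_eq0 (R : realType) n (f : {ffun 'I_n -> bool} -> bool)
    (S : {set 'I_n}) (i k : 'I_n) : i \in S -> k \in S ->
    (forall x, pm1 R (f x) - pm1 R (f (flip i x)) - pm1 R (f (flip k x))
       + pm1 R (f (flip i (flip k x))) = 0) ->
  fourier R f S = 0.
Proof.
move=> iS kS f0; rewrite /fourier.
set g := fun x : {ffun 'I_n -> bool} =>
  pm1 R (f x) * \prod_(l in S) pm1 R (x l).
suff : \sum_x g x *+ 4 = 0.
  by rewrite -/g sumrMnl => /eqP; rewrite mulrn_eq0 /= => /eqP ->; rewrite mul0r.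
have -> : \sum_x g x *+ 4 =
    \sum_x (g x + g (flip i x) + g (flip k x) + g (flip i (flip k x))).
  rewrite sumrMnl !big_split /=.
  rewrite (sum_flip k (fun x => g (flip i x))) !sum_flip.
  by ring.
apply: big1 => x _; rewrite /g !prod_pm1_flip //.
by rewrite -[RHS](mul0r (\prod_(l in S) pm1 R (x l))) -(f0 x); ring.
Qed.

Lemma card_gt_cover_collision (T : finType) d (A : 'I_d -> {set T})
    (S : {set T}) : \bigcup_j A j = [set: T] -> (d < #|S|)%N ->
  exists i k j, [/\ i \in S, k \in S, i != k, i \in A j & k \in A j].
Proof.
move=> covA dS.
have [b bA] : exists b : T -> 'I_d, forall i, i \in A (b i).
  apply: (@fin_all_exists _ (fun=> 'I_d) (fun i j => i \in A j)) => i.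
  have : i \in \bigcup_j A j by rewrite covA inE.
  by case/bigcupP => j _; exists j.
(* Pigeonhole: if the block choice [b] were injective on [S], then [S] would embed in ['I_d]. *)
have /dinjectivePn[i iS [k /andP[/= ki kS] bik]] : ~~ dinjectiveb b (mem S).
  apply/negP => /dinjectiveP binj; move: dS.
  by rewrite -(card_in_imset binj) ltnNge -[X in (_ <= X)%N]card_ord max_card.
by exists i, k, (b i); split; rewrite 1?eq_sym // bik.
Qed.

Theorem lemma1p13 (R : realType) (d n : nat) (hd : (1 <= d)%N) (hn : (1 <= n)%N)
    (p : {mpoly R[n]}) (f : {ffun 'I_n -> bool} -> bool)
    (hp : block_multilinear d p) (hpf : approximates (1 / 3%:R) p f) :
  (bdeg R f <= d)%N.
Proof.
have [_ [A [_ covA cardA]]] := hp.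
apply/bigmax_leqP => S; apply: contraR; rewrite -ltnNge => dS; apply/eqP.
have [i [k [j [iS kS ik iA kA]]]] := card_gt_cover_collision covA dS.
apply: (fourier_eq0 iS kS) => x.
apply: (approximates_second_difference x _ hpf) => [|m mp]; first by lra.
(* Two positive exponents would put both [i] and [k] from block [A j] into the monomial [m]. *)
rewrite -[_ || _]negbK negb_or -!lt0n; apply/negP => /andP[mi mk].
move: (cardA m mp j); rewrite leqNgt => /negP; apply.
by apply/card_gt1P; exists i, k; rewrite !inE iA kA.
Qed.
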